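(* Let $f:\mathbb{R}^m\to\mathbb{R}$ be convex with $L$-Lipschitz-continuous gradient and $\mu$-strongly convex ($\mu\ge0$, where $\mu=0$ means convex), let $x_*$ be a minimizer of $f$, and let $\{1,\dots,m\}$ be divided into $n$ disjoint blocks. After $k\ge1$ steps of the accelerated alternating minimization (AAM) algorithm with parameter $\mu$ started at $x^0$ it holds that $$f(x^k)-f(x_* )\le nLR^2\min\left\{\frac{4}{k^2},\ \left(1-\sqrt{\frac{\mu}{nL}}\right)^{k-1}\right\},$$ where $R=\|x^0-x_*\|_2$.
   Context: Blocks: the set $\{1,\dots,m\}$ of indices of the orthonormal basis vectors $e_1,\dots,e_m$ is divided into $n$ disjoint subsets $I_1,\dots,I_n$; $S_i(x)=x+\operatorname{span}\{e_j:j\in I_i\}$; $\nabla_i f(x)$ is the part of $\nabla f(x)$ corresponding to block $i$. It is assumed that for every $i$ and every $z\in\mathbb{R}^m$ the problem $\min_{x\in S_i(z)}f(x)$ has a solution. AAM algorithm with parameter $\mu$: given a starting point $x^0$, set $A_0=0$, $v^0=x^0$, $\tau_0=1$. For $k=0,1,2,\dots$: 1. $\beta_k=\operatorname{argmin}_{\beta\in[0,1]}f(x^k+\beta(v^k-x^k))$ and $y^k=x^k+\beta_k(v^k-x^k)$; 2. $i_k=\operatorname{argmax}_{i\in\{1,\dots,n\}}\|\nabla_i f(y^k)\|_2$ and $x^{k+1}=\operatorname{argmin}_{x\in S_{i_k}(y^k)}f(x)$; 3. if $L$ is known, choose $a_{k+1}$ such that $\frac{a_{k+1}^2}{(A_k+a_{k+1})(\tau_k+\mu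 a_{k+1})}=\frac1{Ln}$; if $L$ is unknown, find the largest $a_{k+1}$ from the equation $$f(y^k)-\frac{a_{k+1}^2}{2(A_k+a_{k+1})(\tau_k+\mu a_{k+1})}\|\nabla f(y^k)\|_2^2+\frac{\mu\tau_k a_{k+1}}{2(A_k+a_{k+1})(\tau_k+\mu a_{k+1})}\|v^k-y^k\|_2^2=f(x^{k+1});$$ 4. $A_{k+1}=A_k+a_{k+1}$, $\tau_{k+1}=\tau_k+\mu a_{k+1}$; 5. $v^{k+1}=v^k-a_{k+1}\nabla f(y^k)$.
   Formalization: For μ>0, step 5 is corrected from v^{k+1}=v^k−a_{k+1}∇f(y^k) to v^{k+1}=(τ_k v^k+μa_{k+1}y^k−a_{k+1}∇f(y^k))/τ_{k+1}; with the printed rule the bound can fail when L is unknown. For μ=0 the two rules coincide. *)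

(* Defs.v *)
From HB Require Import structures.
From mathcomp Require Import all_boot all_order all_algebra.
From mathcomp Require Import all_classical all_reals all_analysis.

Set Implicit Arguments.
Unset Strict Implicit.
Unset Printing Implicit Defensive.

Import Order.TTheory GRing.Theory Num.Theory.
Import numFieldNormedType.Exports.

Local Open Scope classical_set_scope.
Local Open Scope ring_scope.

(* The norm `|x| that the library puts on 'rV[R]_m is the sup norm, hence this
   separate Euclidean norm. The topology, and so differentiability, is the
   same for both. *)
Definition norm2 (R : realType) (m : nat) (x : 'rV[R]_m) : R :=
  Num.sqrt (\sum_(j < m) x 0 j ^+ 2).

Definition grad (R : realType) (m : nat) (f : 'rV[R]_m -> R) (x : 'rV[R]_m) :
    'rV[R]_m :=
  \row_(j < m) 'D_(delta_mx 0 j) f x.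

Definition lipschitz_grad (R : realType) (m : nat) (L : R)
    (f : 'rV[R]_m -> R) : Prop :=
  (forall x, differentiable f x) /\
  (forall x y, norm2 (grad f x - grad f y) <= L * norm2 (x - y)).

Definition strongly_convex (R : realType) (m : nat) (mu : R)
    (f : 'rV[R]_m -> R) : Prop :=
  forall (x y : 'rV[R]_m) (t : R), 0 <= t <= 1 ->
    f (t *: x + (1 - t) *: y) <=
    t * f x + (1 - t) * f y - mu / 2 * t * (1 - t) * norm2 (x - y) ^+ 2.

Definition is_argmin (R : realType) (T : Type) (D : set T) (g : T -> R)
    (x : T) : Prop :=
  D x /\ forall y, D y -> g x <= g y.

Definition is_block_division (m n : nat) (I : 'I_n -> {set 'I_m}) : Prop :=
  (forall i j l, l \in I i -> l \in I j -> i = j) /\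
  (forall l : 'I_m, exists i, l \in I i).

(* z + span {e_j : j \in J} *)
Definition block_affine (R : realType) (m : nat) (J : {set 'I_m})
    (z : 'rV[R]_m) : set 'rV[R]_m :=
  [set x | exists c : 'I_m -> R,
     x = z + \sum_(j in J) c j *: delta_mx 0 j].

Definition block_grad (R : realType) (m : nat) (J : {set 'I_m})
    (f : 'rV[R]_m -> R) (x : 'rV[R]_m) : 'rV[R]_m :=
  \row_(j < m) (if j \in J then grad f x 0 j else 0).

(* For k > 0 the equation also has a negative root; the step size is the
   positive one. *)
Definition known_L_step (R : realType) (n : nat) (L mu A tau a : R) : Prop :=
  0 < a /\ a ^+ 2 / ((A + a) * (tau + mu * a)) = 1 / (L * n%:R).

(* The disequalities exclude spurious solutions coming from x / 0 = 0, e.g.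
   a = 0 when A = 0. *)
Definition unknown_L_solutions (R : realType) (m : nat) (f : 'rV[R]_m -> R)
    (mu A tau : R) (y v x' : 'rV[R]_m) : set R :=
  [set a | [/\ A + a != 0, tau + mu * a != 0 &
     f y - a ^+ 2 / (2 * (A + a) * (tau + mu * a)) * norm2 (grad f y) ^+ 2
         + mu * tau * a / (2 * (A + a) * (tau + mu * a)) * norm2 (v - y) ^+ 2
     = f x']].

Definition unknown_L_step (R : realType) (m : nat) (f : 'rV[R]_m -> R)
    (mu A tau : R) (y v x' : 'rV[R]_m) (a : R) : Prop :=
  unknown_L_solutions f mu A tau y v x' a /\
  ubound (unknown_L_solutions f mu A tau y v x') a.

Record aam_seq (R : realType) (m n : nat) := AamSeq {
  ax : nat -> 'rV[R]_m;
  ay : nat -> 'rV[R]_m;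
  av : nat -> 'rV[R]_m;
  abeta : nat -> R;
  aidx : nat -> 'I_n;
  aa : nat -> R;          (* aa k.+1 is the step size a_{k+1}; aa 0 is unused *)
  aA : nat -> R;
  atau : nat -> R
}.

(* The update of v is the minimizer of the estimate function
     psi_{k+1}(x) = psi_k(x) + a_{k+1} (f(y^k) + <grad f(y^k), x - y^k>
                                        + mu/2 |x - y^k|^2),
   psi_0(x) = |x - x^0|^2 / 2, namely
     tau_{k+1} v^{k+1} = tau_k v^k + mu a_{k+1} y^k - a_{k+1} grad f(y^k).
   For mu = 0 it reads v^{k+1} = v^k - a_{k+1} grad f(y^k). Keeping the latter
   formula for mu > 0 is inconsistent with the |v^k - y^k|^2 term of the
   unknown-L equation, and with that rule the convergence bound then fails. *)
Definition aam_step (R : realType) (m n : nat) (L_known : bool)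
    (f : 'rV[R]_m -> R) (L mu : R) (I : 'I_n -> {set 'I_m})
    (s : aam_seq R m n) (k : nat) : Prop :=
  let x := ax s in let y := ay s in let v := av s in
  let a := aa s in let A := aA s in let tau := atau s in
  [/\ is_argmin `[0, 1] (fun b : R => f (x k + b *: (v k - x k))) (abeta s k) /\
        y k = x k + abeta s k *: (v k - x k),
      (forall i, norm2 (block_grad (I i) f (y k)) <=
                 norm2 (block_grad (I (aidx s k)) f (y k))) /\
        is_argmin (block_affine (I (aidx s k)) (y k)) f (x k.+1),
      (if L_known then known_L_step n L mu (A k) (tau k) (a k.+1)
       else unknown_L_step f mu (A k) (tau k) (y k) (v k) (x k.+1) (a k.+1)),
      A k.+1 = A k + a k.+1 /\ tau k.+1 = tau k + mu * a k.+1 &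
      v k.+1 = (tau k.+1)^-1 *:
        (tau k *: v k + (mu * a k.+1) *: y k - a k.+1 *: grad f (y k))].

(* Only the first K steps are required: the unknown-L rule need not have a
   solution once an exact minimizer has been reached. *)
Definition aam_run (R : realType) (m n : nat) (L_known : bool)
    (f : 'rV[R]_m -> R) (L mu : R) (I : 'I_n -> {set 'I_m})
    (x0 : 'rV[R]_m) (K : nat) (s : aam_seq R m n) : Prop :=
  [/\ ax s 0%N = x0, av s 0%N = x0, aA s 0%N = 0, atau s 0%N = 1 &
      forall k, (k < K)%N -> aam_step L_known f L mu I s k].

(* Main.v *)
(* Let z be the minimizer. A_k (f(x^k) - f(z)) + tau_k / 2 |z - v^k|^2 does not
   increase: add a_{k+1} times the strong convexity inequality at y^k to
   tau_k / 2 |z - v^k|^2, complete the square in z, and use that the line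
   search gives <grad f(y^k), v^k - y^k> >= 0 and f(y^k) <= f(x^k). Hence
   f(x^k) - f(z) <= R^2 / (2 A_k). By the greedy choice of the block,
   f(x^{k+1}) <= f(y^k) - |grad f(y^k)|^2 / (2 n L), so that both step rules
   satisfy n L a_{k+1}^2 >= A_{k+1} tau_{k+1}, where tau_k = 1 + mu A_k.
   This forces A_k >= k^2 / (4 n L), and, as a_{k+1} >= q A_{k+1} for
   q = sqrt (mu / (n L)), also A_k <= (1 - q) A_{k+1}, with A_1 >= 1 / (n L).
   The unknown-L step can be nonpositive once f(x^{k+1}) = f(z), but then f
   stays minimal along the run and the bound only says that its right-hand side
   is nonnegative, which holds since mu <= L unless x^0 = z. *)

Require Import Defs.
From HB Require Import structures.
From mathcomp Require Import all_boot all_order all_algebra.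
From mathcomp Require Import all_classical all_reals all_analysis.
From mathcomp Require Import ring lra.

Set Implicit Arguments.
Unset Strict Implicit.
Unset Printing Implicit Defensive.

Import Order.TTheory GRing.Theory Num.Theory.
Import numFieldNormedType.Exports.

Local Open Scope classical_set_scope.
Local Open Scope ring_scope.

(** * Euclidean inner product and norm *)

Definition dotv (R : realType) (m : nat) (x y : 'rV[R]_m) : R :=
  \sum_(j < m) x 0 j * y 0 j.

Section Euclidean.
Context {R : realType} {m : nat}.
Implicit Types x y z : 'rV[R]_m.

Lemma dotvC x y : dotv x y = dotv y x.
Proof. by apply: eq_bigr => j _; rewrite mulrC. Qed.

Lemma dotvDr x y z : dotv x (y + z) = dotv x y + dotv x z.
Proof. by rewrite -big_split; apply: eq_bigr => j _; rewrite !mxE mulrDr. Qed.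

Lemma dotvZr (c : R) x y : dotv x (c *: y) = c * dotv x y.
Proof. by rewrite mulr_sumr; apply: eq_bigr => j _; rewrite !mxE mulrCA. Qed.

Lemma dotvNr x y : dotv x (- y) = - dotv x y.
Proof. by rewrite -scaleN1r dotvZr mulN1r. Qed.

Lemma dotvDl x y z : dotv (x + y) z = dotv x z + dotv y z.
Proof. by rewrite dotvC dotvDr !(dotvC z). Qed.

Lemma dotvZl (c : R) x y : dotv (c *: x) y = c * dotv x y.
Proof. by rewrite dotvC dotvZr dotvC. Qed.

Lemma dotvNl x y : dotv (- x) y = - dotv x y.
Proof. by rewrite dotvC dotvNr dotvC. Qed.

Definition dotvE := (dotvDr, dotvDl, dotvNr, dotvNl, dotvZr, dotvZl).

Lemma dotv_ge0 x : 0 <= dotv x x.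
Proof. by apply: sumr_ge0 => j _; rewrite -expr2 sqr_ge0. Qed.

Lemma norm2_ge0 x : 0 <= norm2 x.
Proof. exact: sqrtr_ge0. Qed.

Lemma sqr_norm2 x : norm2 x ^+ 2 = dotv x x.
Proof.
rewrite sqr_sqrtr; first by apply: eq_bigr => j _; rewrite expr2.
by apply: sumr_ge0 => j _; rewrite sqr_ge0.
Qed.

Lemma norm2_eq0 x : norm2 x = 0 -> x = 0.
Proof.
move=> /(congr1 (fun r => r ^+ 2)); rewrite sqr_norm2 expr0n /= => x0.
apply/rowP => j; rewrite mxE; apply/eqP; rewrite -sqrf_eq0 expr2.
move/eqP: x0; rewrite psumr_eq0 => [|i _]; last by rewrite -expr2 sqr_ge0.
by move/allP => /(_ j (mem_index_enum j)).
Qed.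

Lemma norm2Z (c : R) x : norm2 (c *: x) = `|c| * norm2 x.
Proof.
apply/eqP; rewrite -(@eqrXn2 _ 2) ?mulr_ge0 ?norm2_ge0//.
by rewrite exprMn !sqr_norm2 !dotvE real_normK ?num_real// expr2 mulrA.
Qed.

(** Cauchy-Schwarz: expand the squared norm of [norm2 y *: x - norm2 x *: y] and divide by the
    product of the norms, the zero vectors being treated apart. *)
Lemma dotv_le x y : dotv x y <= norm2 x * norm2 y.
Proof.
have [x0|xn0] := eqVneq (norm2 x) 0.
  rewrite (norm2_eq0 x0) -[X in dotv X y](scale0r 0) dotvZl mul0r.
  by rewrite mulr_ge0 ?norm2_ge0.
have [y0|yn0] := eqVneq (norm2 y) 0.
  rewrite (norm2_eq0 y0) -[X in dotv x X](scale0r 0) dotvZr mul0r.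
  by rewrite mulr_ge0 ?norm2_ge0.
have xp : 0 < norm2 x by rewrite lt_def xn0 norm2_ge0.
have yp : 0 < norm2 y by rewrite lt_def yn0 norm2_ge0.
have := dotv_ge0 (norm2 y *: x - norm2 x *: y).
rewrite !dotvE (dotvC y x) -!sqr_norm2 => h.
rewrite -(ler_pM2l (mulr_gt0 xp yp)); lra.
Qed.

End Euclidean.

(** * Quadratic bounds from the Lipschitz gradient *)

Section Smooth.
Context {R : realType} {m : nat}.
Variables (f : 'rV[R]_m -> R) (L : R).
Hypothesis f_smooth : lipschitz_grad L f.
Implicit Types x y d : 'rV[R]_m.

Lemma derive_grad x d : 'D_d f x = dotv (grad f x) d.
Proof.
have [df _] := f_smooth; rewrite deriveE// {1}[d]row_sum_delta linear_sum.
by apply: eq_bigr => j _; rewrite linearZ /= mxE deriveE// mulrC.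
Qed.

Lemma is_derive_line y d (t : R) :
  is_derive t 1 (fun t : R => f (y + t *: d)) (dotv (grad f (y + t *: d)) d).
Proof.
have [df _] := f_smooth; rewrite -derive_grad.
(* The difference quotient along the line at [t] is the one of [f] at [y + t *: d] in direction [d],
   so no chain rule is involved. *)
have lineE : (fun h : R => h^-1 *: (f (y + (h *: 1 + t) *: d) - f (y + t *: d)))
    = (fun h : R => h^-1 *: (f (h *: d + (y + t *: d)) - f (y + t *: d))).
  apply/funext => h; congr (_ *: (f _ - _)).
  by rewrite scalerDl addrCA /GRing.scale /= mulr1.
apply: DeriveDef; last by rewrite /derive /= lineE.
by rewrite /derivable /= lineE; exact: diff_derivable.
Qed.

(** Mean value theorem on [0, 1] for [h] minus its quadratic model, whose derivative is nonpositive
    for t >= 0. It is applied to [f] on a line and to its negative. *)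
Lemma quadratic_upper (h dh : R -> R) (K : R) :
    (forall t : R, is_derive t 1 h (dh t)) ->
    (forall t, 0 <= t -> dh t <= dh 0 + K * t) ->
  h 1 <= h 0 + dh 0 + K / 2.
Proof.
move=> hd dh_le.
pose g t := h t - (dh 0 * t + K / 2 * t ^+ 2).
have gd (t : R) : is_derive t 1 g (dh t - (dh 0 + K * t)).
  apply: is_derive_eq; rewrite /GRing.scale /=; lra.
have [|c /andP[c0 _]] := MVT ltr01 (fun t _ => gd t).
  by apply: derivable_within_continuous => t _; have [] := gd t.
move: c0; rewrite bnd_simp => /ltW/dh_le dc; rewrite /g; lra.
Qed.

Lemma grad_line_le y d (t : R) : 0 <= t ->
  `|dotv (grad f (y + t *: d)) d - dotv (grad f y) d| <=
    L * dotv d d * t.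
Proof.
move=> t0; have [_ lip] := f_smooth.
have lipt x z : norm2 (x - z) = t * norm2 d ->
    dotv (grad f x) d - dotv (grad f z) d <= L * dotv d d * t.
  move=> xz; rewrite -dotvNl -dotvDl.
  apply: (le_trans (dotv_le _ _)); rewrite -sqr_norm2.
  apply: (@le_trans _ _ (L * norm2 (x - z) * norm2 d)).
    by rewrite ler_wpM2r ?norm2_ge0.
  by rewrite xz expr2; lra.
rewrite ler_norml lerNl opprB !lipt//.
  by rewrite addrAC subrr add0r norm2Z ger0_norm.
by rewrite opprD addrA subrr add0r -scaleNr norm2Z normrN ger0_norm.
Qed.

Lemma descent y d : f (y + d) <= f y + dotv (grad f y) d + L / 2 * dotv d d.
Proof.
have H : f (y + 1 *: d) <= f (y + 0 *: d) + dotv (grad f (y + 0 *: d)) d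
    + L * dotv d d / 2.
  apply: (quadratic_upper (is_derive_line y d)) => t /(grad_line_le y d).
  by rewrite scale0r addr0 ler_norml => /andP[_]; lra.
move: H; rewrite scale1r scale0r addr0; lra.
Qed.

Lemma ascent y d : f y + dotv (grad f y) d - L / 2 * dotv d d <= f (y + d).
Proof.
have H : - f (y + 1 *: d) <= - f (y + 0 *: d) - dotv (grad f (y + 0 *: d)) d
    + L * dotv d d / 2.
  apply: (quadratic_upper (fun t => is_deriveN (is_derive_line y d t))) => t.
  move=> /(grad_line_le y d).
  by rewrite scale0r addr0 ler_norml => /andP[+ _]; lra.
move: H; rewrite scale1r scale0r addr0; lra.
Qed.

End Smooth.

(** Replaces letting t tend to 0 in the first-order arguments below. *)
Lemma ge0_of_linear_lower (R : realType) (a K : R) :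
  (forall t, 0 < t <= 1 -> - (K * t) <= a) -> 0 <= a.
Proof.
move=> aK; rewrite leNgt; apply/negP => a0.
(* If a < 0, then t = -a / (2 M) lies in (0, 1], and K t <= M t = -a / 2 < -a contradicts the
   hypothesis. *)
pose M := `|K| - a; have M0 : 0 < M by rewrite /M; have := normr_ge0 K; lra.
have tM : - a / (2 * M) * (2 * M) = - a by rewrite mulfVK// gt_eqF ?mulr_gt0.
have t0 : 0 < - a / (2 * M) by rewrite divr_gt0 ?mulr_gt0 ?oppr_gt0.
have KM : K <= M by rewrite /M; have := ler_norm K; lra.
have aM : - a <= M by rewrite /M; have := normr_ge0 K; lra.
have t1 : - a / (2 * M) <= 1 by rewrite ler_pdivrMr ?mulr_gt0//; lra.
have := aK (- a / (2 * M)); rewrite t0 t1 => /(_ isT).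
move: tM t0; set t := _ / _ => tM t0; nra.
Qed.

(** * First-order consequences of strong convexity and of the line search *)

Section StronglyConvex.
Context {R : realType} {m : nat}.
Variables (f : 'rV[R]_m -> R) (L mu : R).
Hypotheses (f_smooth : lipschitz_grad L f) (f_strong : strongly_convex mu f).
Implicit Types x y v d : 'rV[R]_m.

(** Divide strong convexity on the segment from [y] to [y + d] by t and let t tend to 0. In the
    error constant, L / 2 comes from [ascent] and mu / 2 from the factor 1 - t. *)
Lemma strong_lower y d :
  f y + dotv (grad f y) d + mu / 2 * dotv d d <= f (y + d).
Proof.
rewrite -subr_ge0; apply: (@ge0_of_linear_lower _ _ ((L + mu) / 2 * dotv d d)).
move=> t /andP[t0 t1].
have /(f_strong (y + d) y) : 0 <= t <= 1 by rewrite ltW.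
have -> : t *: (y + d) + (1 - t) *: y = y + t *: d.
  by apply/rowP => j; rewrite !mxE; ring.
have -> : y + d - y = d by rewrite addrC addKr.
rewrite sqr_norm2.
have := ascent f_smooth y (t *: d); rewrite !(dotvZr, dotvZl) => h1 h2.
rewrite -(ler_pM2l t0); lra.
Qed.

(** Polyak-Lojasiewicz inequality. Minimizing [strong_lower] over d would divide by mu; multiplying
    by mu and using |grad f y + mu d|^2 >= 0 covers mu = 0 as well. *)
Lemma gradient_domination x y : 0 <= mu ->
  2 * mu * (f y - f x) <= dotv (grad f y) (grad f y).
Proof.
move=> mu0; have := strong_lower y (x - y); rewrite [y + _]addrC subrK.
move: (x - y) => d h1; have := dotv_ge0 (grad f y + mu *: d).
rewrite !dotvE (dotvC d) => h2; have := ler_wpM2l mu0 h1; lra.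
Qed.

Lemma grad_sqr_gt0 x y : 0 <= mu -> f x < f y -> 0 < dotv (grad f y) (grad f y).
Proof.
move=> mu0 fxy; rewrite lt_def dotv_ge0 andbT; apply/eqP => g0.
have gy0 : grad f y = 0 by apply: norm2_eq0; apply/eqP;
  rewrite -sqrf_eq0 sqr_norm2 g0.
have := strong_lower y (x - y); rewrite [y + _]addrC subrK gy0.
rewrite -(scale0r 0) dotvZl mul0r.
have := mulr_ge0 mu0 (dotv_ge0 (x - y)); lra.
Qed.

Lemma strong_le_smooth x y : x != y -> mu <= L.
Proof.
move=> xy; have := strong_lower y (x - y); have := descent f_smooth y (x - y).
have : 0 < dotv (x - y) (x - y).
  rewrite lt_def dotv_ge0 andbT -sqr_norm2 sqrf_eq0.
  by apply: contra_neq xy => /norm2_eq0/subr0_eq.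
by move=> d0 h1 h2; rewrite -(ler_pM2r d0); lra.
Qed.

Lemma line_search x v y (b : R) :
    is_argmin `[0, 1] (fun b : R => f (x + b *: (v - x))) b ->
    y = x + b *: (v - x) ->
  f y <= f x /\ 0 <= dotv (grad f y) (v - y).
Proof.
move=> [/=]; rewrite in_itv /= => /andP[b0 b1] bmin yE; split.
  by have := bmin 0; rewrite scale0r addr0 yE; apply;
    rewrite /= in_itv /= lexx ler01.
apply: (@ge0_of_linear_lower _ _ (L / 2 * dotv (v - y) (v - y))).
move=> t /andP[t0 t1].
have : f y <= f (y + t *: (v - y)).
  (* Moving from [y] towards [v] stays on the searched segment: the parameter b + t (1 - b) is again
     in [0, 1]. *)
  have -> : y + t *: (v - y) = x + (b + t * (1 - b)) *: (v - x).
    by rewrite yE; apply/rowP => j; rewrite !mxE; ring.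
  by rewrite {1}yE; apply: bmin; rewrite /= in_itv /=; nra.
move=> h1; have := descent f_smooth y (t *: (v - y)).
rewrite !(dotvZr, dotvZl) => h2.
rewrite -(ler_pM2l t0); lra.
Qed.

End StronglyConvex.

(** * Decrease obtained by minimizing over a greedily chosen block *)

Section Blocks.
Context {R : realType} {m : nat}.
Variables (f : 'rV[R]_m -> R) (L : R).
Hypotheses (L_gt0 : 0 < L) (f_smooth : lipschitz_grad L f).

Lemma block_gradE (J : {set 'I_m}) (y : 'rV[R]_m) :
  block_grad J f y = \sum_(j in J) grad f y 0 j *: delta_mx 0 j.
Proof.
rewrite big_mkcond [LHS]row_sum_delta; apply: eq_bigr => j _.
by rewrite [block_grad _ _ _ _ _]mxE; case: ifP; rewrite ?scale0r.
Qed.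

Lemma dotv_block_grad (J : {set 'I_m}) (y : 'rV[R]_m) :
  dotv (grad f y) (block_grad J f y) = norm2 (block_grad J f y) ^+ 2.
Proof.
rewrite sqr_norm2; apply: eq_bigr => j _.
by rewrite [block_grad _ _ _ _ _]mxE; case: ifP; rewrite ?mulr0.
Qed.

(** The exact block minimizer is at least as good as a gradient step of length 1 / L within the
    block. *)
Lemma block_descent (J : {set 'I_m}) (y x' : 'rV[R]_m) :
    is_argmin (block_affine J y) f x' ->
  f x' <= f y - norm2 (block_grad J f y) ^+ 2 / (2 * L).
Proof.
move=> [_ x'min]; have := descent f_smooth y (- L^-1 *: block_grad J f y).
rewrite !(dotvZl, dotvZr) dotv_block_grad -sqr_norm2 => h.
have /x'min/le_trans : block_affine J y (y + - L^-1 *: block_grad J f y).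
  exists (fun j => - L^-1 * grad f y 0 j); congr (_ + _).
  rewrite block_gradE scaler_sumr; apply: eq_bigr => j _.
  by rewrite scalerA.
apply; apply: (le_trans h); rewrite le_eqVlt; apply/orP; left; apply/eqP.
by field; rewrite gt_eqF.
Qed.

(** Every coordinate lies in some block, so its square occurs at least once on the right. *)
Lemma sqr_norm_grad_le_blocks (n : nat) (I : 'I_n -> {set 'I_m})
    (y : 'rV[R]_m) :
    (forall l, exists i, l \in I i) ->
  dotv (grad f y) (grad f y) <= \sum_i norm2 (block_grad (I i) f y) ^+ 2.
Proof.
move=> cover; under eq_bigr do rewrite -dotv_block_grad.
rewrite exchange_big; apply: ler_sum => l _ /=.
have term_ge0 i : 0 <= grad f y 0 l * block_grad (I i) f y 0 l.
  rewrite [block_grad _ _ _ _ _]mxE; case: ifP; rewrite ?mulr0//.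
  by rewrite -expr2 sqr_ge0.
have [i li] := cover l; rewrite (bigD1 i)//= [block_grad _ _ _ _ _]mxE li.
by rewrite lerDl sumr_ge0.
Qed.

(** The block with the largest gradient carries at least 1 / n of the squared norm of the full
    gradient. *)
Lemma greedy_block_descent (n : nat) (I : 'I_n -> {set 'I_m}) (i0 : 'I_n)
    (y x' : 'rV[R]_m) :
    (forall l, exists i, l \in I i) ->
    (forall i, norm2 (block_grad (I i) f y) <=
               norm2 (block_grad (I i0) f y)) ->
    is_argmin (block_affine (I i0) y) f x' ->
  f x' <= f y - dotv (grad f y) (grad f y) / (2 * (L * n%:R)).
Proof.
move=> cover i0max /block_descent/le_trans; apply.
have n0 : 0 < n%:R :> R by rewrite ltr0n (leq_ltn_trans _ (ltn_ord i0)).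
set N := norm2 _ ^+ 2.
have GN : dotv (grad f y) (grad f y) <= n%:R * N.
  apply: (le_trans (sqr_norm_grad_le_blocks y cover)).
  rewrite mulr_natl -[n in _ *+ n]card_ord -sumr_const.
  by apply: ler_sum => i _; rewrite lerXn2r ?nnegrE ?norm2_ge0.
rewrite lerD2l lerN2 ler_pdivrMr ?mulr_gt0//; apply: (le_trans GN).
by rewrite le_eqVlt; apply/orP; left; apply/eqP; field; rewrite gt_eqF.
Qed.

End Blocks.

(** * One step: Lyapunov function and step size *)

Section Step.
Context {R : realType} {m : nat}.
Variables (f : 'rV[R]_m -> R) (L mu : R).
Hypotheses (mu_ge0 : 0 <= mu).
Hypotheses (f_smooth : lipschitz_grad L f) (f_strong : strongly_convex mu f).
Variables (A tau a : R).
Hypotheses (A_ge0 : 0 <= A) (tau_gt0 : 0 < tau) (a_gt0 : 0 < a).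

(* w minimizes the left-hand side over z: this is the completed square. *)
Lemma estimate_function_min (z v y g w : 'rV[R]_m) :
    w = (tau + mu * a)^-1 *: (tau *: v + (mu * a) *: y - a *: g) ->
  tau / 2 * norm2 (z - v) ^+ 2 +
    a * (dotv g (z - y) + mu / 2 * norm2 (z - y) ^+ 2) =
  tau * mu * a / (2 * (tau + mu * a)) * norm2 (v - y) ^+ 2 +
    a * tau / (tau + mu * a) * dotv g (v - y) -
    a ^+ 2 / (2 * (tau + mu * a)) * dotv g g +
    (tau + mu * a) / 2 * norm2 (z - w) ^+ 2.
Proof.
move=> ->; have t0 : tau + mu * a != 0.
  by rewrite gt_eqF// ltr_wpDr// mulr_ge0// ltW.
rewrite !sqr_norm2 /dotv !mulr_sumr -!big_split /=.
rewrite !mulr_sumr -sumrN -!big_split /=.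
by apply: eq_bigr => j _; rewrite !mxE; field.
Qed.

(** Multiplied by [A + a], the bound on [f x'] has exactly the |grad f y|^2 and |v - y|^2 terms left
    by [estimate_function_min], so they cancel. An inequality is assumed so as to serve both rules:
    the unknown-L equation gives it with equality. *)
Lemma lyapunov_decrease (x v y x' w z : 'rV[R]_m) :
    f y <= f x -> 0 <= dotv (grad f y) (v - y) ->
    w = (tau + mu * a)^-1 *: (tau *: v + (mu * a) *: y - a *: grad f y) ->
    f x' <= f y - a ^+ 2 / (2 * (A + a) * (tau + mu * a)) *
                    norm2 (grad f y) ^+ 2
      + mu * tau * a / (2 * (A + a) * (tau + mu * a)) * norm2 (v - y) ^+ 2 ->
  (A + a) * (f x' - f z) + (tau + mu * a) / 2 * norm2 (z - w) ^+ 2 <=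
  A * (f x - f z) + tau / 2 * norm2 (z - v) ^+ 2.
Proof.
move=> fyx gvy wE; have t'0 : 0 < tau + mu * a.
  by rewrite ltr_wpDr// mulr_ge0// ltW.
have A'0 : 0 < A + a by rewrite ltr_wpDl.
move=> /(ler_wpM2l (ltW A'0)); have := estimate_function_min z wE.
have := strong_lower f_smooth f_strong y (z - y); rewrite [y + _]addrC subrK.
rewrite -sqr_norm2 -[dotv (grad f y) (grad f y)]sqr_norm2.
move=> /(ler_wpM2l (ltW a_gt0)) fz psi fx'.
have Afyx := ler_wpM2l A_ge0 fyx.
have gvy' : 0 <= a * tau / (tau + mu * a) * dotv (grad f y) (v - y).
  by rewrite mulr_ge0// divr_ge0 ?mulr_ge0 ?ltW.
have E : (A + a) * (f y - a ^+ 2 / (2 * (A + a) * (tau + mu * a)) *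
      norm2 (grad f y) ^+ 2
      + mu * tau * a / (2 * (A + a) * (tau + mu * a)) * norm2 (v - y) ^+ 2) =
    A * f y + a * f y -
      a ^+ 2 / (2 * (tau + mu * a)) * norm2 (grad f y) ^+ 2
      + tau * mu * a / (2 * (tau + mu * a)) * norm2 (v - y) ^+ 2.
  by field; rewrite !gt_eqF.
move: fx'; rewrite E; lra.
Qed.

End Step.

(* The equation for the step is p a^2 - q a - r = 0 with p, q > 0 and r >= 0,
   where p > 0 because x' is not yet a minimizer; otherwise p = 0 can happen and
   the largest solution need not be positive. *)
Lemma unknown_L_step_gt0 (R : realType) (m : nat) (f : 'rV[R]_m -> R)
    (mu A tau a : R) (y v x' : 'rV[R]_m) :
    0 <= mu -> 0 <= A -> 0 < tau -> f x' < f y ->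
    2 * mu * (f y - f x') < dotv (grad f y) (grad f y) ->
    unknown_L_step f mu A tau y v x' a ->
  0 < a.
Proof.
move=> mu0 A0 tau0 fx'y pg [_ amax].
pose D := f y - f x'; have D0 : 0 < D by rewrite subr_gt0.
pose V := norm2 (v - y) ^+ 2.
pose G := norm2 (grad f y) ^+ 2.
have GE : G = dotv (grad f y) (grad f y) by rewrite /G sqr_norm2.
pose p := G - 2 * mu * D; have p0 : 0 < p by rewrite /p GE subr_gt0.
pose q := mu * tau * V + 2 * D * (tau + mu * A).
have muA := mulr_ge0 mu0 A0.
have q0 : 0 < q.
  apply: ltr_wpDl; first by rewrite !mulr_ge0 ?norm2_ge0// ltW.
  by apply: mulr_gt0; [rewrite mulr_gt0 | rewrite ltr_wpDr].
pose r := 2 * D * A * tau.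
have r0 : 0 <= r by rewrite /r !mulr_ge0// ltW.
pose e := q ^+ 2 + 4 * p * r.
have e0 : 0 <= e by rewrite addr_ge0 ?sqr_ge0// !mulr_ge0// ltW.
pose b := (q + Num.sqrt e) / (2 * p).
have b0 : 0 < b.
  by rewrite divr_gt0 ?mulr_gt0// ltr_wpDr ?sqrtr_ge0.
have bE : p * b ^+ 2 - q * b - r = 0.
  have -> : p * b ^+ 2 - q * b - r = (Num.sqrt e ^+ 2 - e) / (4 * p).
    by rewrite /b /e; field; rewrite gt_eqF.
  by rewrite sqr_sqrtr// subrr mul0r.
apply: (lt_le_trans b0); apply: amax.
have Ab : 0 < A + b by rewrite ltr_wpDl.
have tb : 0 < tau + mu * b by rewrite ltr_wpDr// mulr_ge0// ltW.
split; rewrite ?gt_eqF//.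
apply/eqP; rewrite -subr_eq0; apply/eqP.
rewrite -/G -/V.
have -> : f y - b ^+ 2 / (2 * (A + b) * (tau + mu * b)) * G +
    mu * tau * b / (2 * (A + b) * (tau + mu * b)) * V - f x' =
    - (p * b ^+ 2 - q * b - r) / (2 * (A + b) * (tau + mu * b)).
  by rewrite /p /q /r /D; field; rewrite !gt_eqF.
by rewrite bE oppr0 mul0r.
Qed.

(** In the equation, the gradient term equals the decrease [f y - f x'] plus a nonnegative |v - y|^2
    term. Its coefficient is therefore at least the guaranteed 1 / (2 c). *)
Lemma unknown_L_step_large (R : realType) (m : nat) (f : 'rV[R]_m -> R)
    (c mu A tau a : R) (y v x' : 'rV[R]_m) :
    0 < c -> 0 <= mu -> 0 <= A -> 0 < tau -> 0 < a ->
    0 < dotv (grad f y) (grad f y) ->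
    f x' <= f y - dotv (grad f y) (grad f y) / (2 * c) ->
    unknown_L_solutions f mu A tau y v x' a ->
  (A + a) * (tau + mu * a) <= c * a ^+ 2.
Proof.
move=> c0 mu0 A0 tau0 a0 g0 fx' [_ _ aE].
have Aa : 0 < A + a by rewrite ltr_wpDl.
have ta : 0 < tau + mu * a by rewrite ltr_wpDr// mulr_ge0// ltW.
have V0 : 0 <= mu * tau * a / (2 * (A + a) * (tau + mu * a)) *
    norm2 (v - y) ^+ 2.
  by rewrite mulr_ge0 ?sqr_ge0// divr_ge0 ?mulr_ge0// ltW.
move: aE fx' V0; rewrite sqr_norm2; set V := _ * norm2 _ ^+ 2.
set G := dotv _ _ in g0 * => aE fx' V0.
have : G / (2 * c) <= a ^+ 2 / (2 * (A + a) * (tau + mu * a)) * G by lra.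
rewrite mulrC ler_pM2r// -mulrA !invfM mulrCA ler_pM2l ?invr_gt0//.
rewrite -invfM ler_pdivlMr ?mulr_gt0// mulrC ler_pdivrMr//.
by rewrite [c * _]mulrC.
Qed.

(** * Steps of the algorithm, with both step rules *)

Section Run.
Context {R : realType} {m n : nat}.
Variables (f : 'rV[R]_m -> R) (L mu : R) (I : 'I_n -> {set 'I_m}).
Hypotheses (L_gt0 : 0 < L) (mu_ge0 : 0 <= mu).
Hypotheses (f_smooth : lipschitz_grad L f) (f_strong : strongly_convex mu f).
Hypothesis cover : forall l, exists i, l \in I i.
Variables (L_known : bool) (s : aam_seq R m n).

Lemma aam_step_noninc (k : nat) : aam_step L_known f L mu I s k ->
  f (ax s k.+1) <= f (ay s k) /\ f (ay s k) <= f (ax s k).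
Proof.
move=> [[bmin yE] [_ [_ xmin]] _ _ _]; split.
  apply: xmin; exists (fun=> 0); rewrite big1 ?addr0// => j _.
  by rewrite scale0r.
by have [] := line_search f_smooth bmin yE.
Qed.

Lemma aam_run_noninc (x0 : 'rV[R]_m) (K i j : nat) :
    aam_run L_known f L mu I x0 K s -> (i <= j <= K)%N ->
  f (ax s j) <= f (ax s i).
Proof.
move=> [_ _ _ _ step] /andP[]; elim: j => [|j IH]; first by case: i.
rewrite leq_eqVlt => /orP[/eqP->//|ij] jK.
have [xy yx] := aam_step_noninc (step j jK).
by apply: (le_trans (le_trans xy yx)); apply: IH; rewrite // ltnW.
Qed.

(** Common interface of the two step rules. The strict gap [f z < f (ax s k.+1)] makes the gradient
    at y^k nonzero and the unknown-L step positive. *)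
Lemma aam_step_progress (k : nat) (z : 'rV[R]_m) :
    aam_step L_known f L mu I s k ->
    0 <= aA s k -> 0 < atau s k -> f z < f (ax s k.+1) ->
  [/\ 0 < aa s k.+1,
      aA s k.+1 * atau s k.+1 <= L * n%:R * aa s k.+1 ^+ 2 &
      aA s k.+1 * (f (ax s k.+1) - f z)
        + atau s k.+1 / 2 * norm2 (z - av s k.+1) ^+ 2 <=
      aA s k * (f (ax s k) - f z) + atau s k / 2 * norm2 (z - av s k) ^+ 2].
Proof.
move=> stepk A0 tau0 fz; have [x'y yx] := aam_step_noninc stepk.
have [[bmin yE] [imax xmin] astep [-> tauE] vE] := stepk.
rewrite {}tauE in vE *.
have [_ gvy] := line_search f_smooth bmin yE.
have x'g := greedy_block_descent L_gt0 f_smooth cover imax xmin.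
have c0 : 0 < L * n%:R.
  by rewrite mulr_gt0// ltr0n (leq_ltn_trans _ (ltn_ord (aidx s k))).
have g0 := grad_sqr_gt0 f_smooth f_strong mu_ge0 (lt_le_trans fz x'y).
move: (aa s k.+1) astep vE => a astep vE.
set A := aA s k in A0 *; set tau := atau s k in tau0 *.
set y := ay s k in x'y yx gvy g0 *; set x' := ax s k.+1 in fz x'y *.
have lyap a0 := lyapunov_decrease mu_ge0 f_smooth f_strong A0 tau0 a0 z
  yx gvy vE.
case: L_known astep => [[a0 aE]|astep].
- move: (L * n%:R) c0 x'g aE => c c0 x'g aE.
  have A'0 : 0 < A + a by rewrite ltr_wpDl.
  have tau'0 : 0 < tau + mu * a by rewrite ltr_wpDr// mulr_ge0// ltW.
  have a2E : (A + a) * (tau + mu * a) = c * a ^+ 2.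
    move: aE => /(canRL (divfK _)) ->; last by rewrite mulf_neq0 ?gt_eqF.
    by rewrite div1r mulVKf ?gt_eqF.
  split=> //; first by rewrite a2E.
  apply: lyap => //; apply: (le_trans x'g).
  (* By [a2E] the gradient coefficient is exactly 1 / (2 c), and the |v - y|^2 term only weakens the
     bound. *)
  rewrite -[2 * _ * _]mulrA a2E sqr_norm2 -[leLHS]addr0; apply: lerD.
    rewrite lerD2l lerN2 le_eqVlt; apply/orP; left; apply/eqP.
    by field; rewrite !gt_eqF.
  by rewrite mulr_ge0 ?sqr_ge0// divr_ge0 ?mulr_ge0 ?sqr_ge0//; exact: ltW.
- have x'ly : f x' < f y.
    by apply: (le_lt_trans x'g); rewrite ltrBlDr ltrDl divr_gt0// mulr_gt0.
  have a0 : 0 < a.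
    apply: (unknown_L_step_gt0 mu_ge0 A0 tau0 x'ly _ astep).
    (* For mu > 0 strictness comes from f z < f x'; for mu = 0 the claim is that the gradient is
       nonzero. *)
    have := gradient_domination f_smooth f_strong z y mu_ge0.
    move: mu_ge0; rewrite le_eqVlt => /orP[/eqP<-|mu0]; first by lra.
    by apply: lt_le_trans; rewrite ltr_pM2l ?mulr_gt0// ltrD2l ltrN2.
  have [asol _] := astep; split=> //.
    exact: (unknown_L_step_large c0 mu_ge0 A0 tau0 a0 g0 x'g asol).
  by apply: lyap => //; have [_ _ ->] := asol.
Qed.

End Run.

(** * Growth of A_k and the resulting rates *)

(** With U = 4 c u, w = 4 c a and J = j, the step inequality times 16 c reads 4 (U + w) <= w^2. Then
    (2 J)^2 <= 4 U <= (w - 2)^2 - 4, so w >= 2 J + 2 and U + w >= (J + 1)^2. *)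
Lemma quadratic_growth (R : realFieldType) (c u a : R) (j : nat) :
    0 < c -> 0 < a -> u + a <= c * a ^+ 2 -> j%:R ^+ 2 <= 4 * c * u ->
  j.+1%:R ^+ 2 <= 4 * c * (u + a).
Proof.
move=> c0 a0 ca ju; rewrite -natr1; have j0 : 0 <= j%:R :> R by [].
set w := 4 * c * a; have w0 : 0 < w by rewrite /w !mulr_gt0.
have {ca} := ler_wpM2l (ltW (mulr_gt0 (ltr0n R 16 : 0 < 16) c0)) ca.
have -> : 16 * c * (c * a ^+ 2) = w ^+ 2 by rewrite /w; ring.
have -> : 16 * c * (u + a) = 4 * (4 * c * u + w) by rewrite /w; ring.
have -> : 4 * c * (u + a) = 4 * c * u + w by rewrite /w; ring.
move: (4 * c * u) (j%:R) ju j0 => U J ju j0 wU.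
have w4 : 4 <= w by rewrite -(ler_pM2l w0); nra.
have : 2 * J <= w - 2.
  by rewrite -ler_sqr ?nnegrE; [nra | lra | lra].
lra.
Qed.

Lemma linear_growth (R : realType) (c mu u a : R) :
    0 < c -> 0 <= mu -> 0 < a -> 0 <= u + a ->
    mu * (u + a) ^+ 2 <= c * a ^+ 2 ->
  u <= (1 - Num.sqrt (mu / c)) * (u + a).
Proof.
move=> c0 mu0 a0 ua h; set q := Num.sqrt _.
have q2 : q ^+ 2 * c = mu.
  by rewrite sqr_sqrtr ?mulfVK ?gt_eqF// divr_ge0// ltW.
have : q * (u + a) <= a.
  rewrite -ler_sqr ?nnegrE ?mulr_ge0 ?sqrtr_ge0 ?(ltW a0)//.
  by rewrite -(ler_pM2l c0) exprMn mulrA [c * _]mulrC q2.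
lra.
Qed.

Section Rate.
Context {R : realType} {m n : nat}.
Variables (f : 'rV[R]_m -> R) (L mu : R) (I : 'I_n -> {set 'I_m}).
Hypotheses (L_gt0 : 0 < L) (mu_ge0 : 0 <= mu).
Hypotheses (f_smooth : lipschitz_grad L f) (f_strong : strongly_convex mu f).
Hypothesis cover : forall l, exists i, l \in I i.
Variables (L_known : bool) (s : aam_seq R m n) (x0 z : 'rV[R]_m) (K : nat).
Hypothesis s_run : aam_run L_known f L mu I x0 K s.
Hypothesis f_gap : f z < f (ax s K).

(** By monotonicity the gap at step [K] holds at all earlier iterates, so every step makes progress.
    The geometric clause is multiplied out because 1 - q, with q the square root, is only shown to
    be nonnegative. *)
Lemma aam_invariant (k : nat) : (k <= K)%N ->
  [/\ 0 <= aA s k, atau s k = 1 + mu * aA s k,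
      aA s k * (f (ax s k) - f z) + atau s k / 2 * norm2 (z - av s k) ^+ 2
        <= norm2 (x0 - z) ^+ 2 / 2,
      k%:R ^+ 2 <= 4 * (L * n%:R) * aA s k &
      (0 < k)%N -> 1 <= L * n%:R * aA s k *
        (1 - Num.sqrt (mu / (L * n%:R))) ^+ (k - 1)].
Proof.
have [sx sv sA stau step] := s_run.
elim: k => [_|k IH kK].
  rewrite sA sx sv stau !(mulr0, mul0r, addr0, add0r) expr0n /=; split=> //.
  have -> : z - x0 = - 1 *: (x0 - z) by rewrite scaleN1r opprB.
  by rewrite norm2Z normrN1 mul1r mul1r mulrC.
have [A0 tauE lyap quad lin] := IH (ltnW kK).
have stepk := step k kK; have [_ _ _ [AE tau'E] _] := stepk.
have c0 : 0 < L * n%:R.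
  by rewrite mulr_gt0// ltr0n (leq_ltn_trans _ (ltn_ord (aidx s k))).
have tau0 : 0 < atau s k by rewrite tauE ltr_wpDr ?mulr_ge0.
have fz : f z < f (ax s k.+1).
  apply: (lt_le_trans f_gap); apply: (aam_run_noninc f_smooth s_run).
  by rewrite kK leqnn.
have [a0 a2 lyap'] :=
  aam_step_progress L_gt0 mu_ge0 f_smooth f_strong cover stepk A0 tau0 fz.
have A'0 : 0 < aA s k.+1 by rewrite AE ltr_wpDl.
have tau'E1 : atau s k.+1 = 1 + mu * aA s k.+1.
  by rewrite tau'E tauE AE mulrDr addrA.
have muA' := mulr_ge0 mu_ge0 (ltW A'0).
split=> //; first exact: ltW.
- exact: le_trans lyap' lyap.
- rewrite AE; apply: quadratic_growth => //; rewrite -AE.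
  apply: le_trans a2; rewrite tau'E1; nra.
move=> _; rewrite subn1 /=.
have A'lin : aA s k <= (1 - Num.sqrt (mu / (L * n%:R))) * aA s k.+1.
  rewrite AE; apply: linear_growth => //; rewrite -AE; first exact: ltW.
  apply: le_trans a2; rewrite tau'E1; nra.
(* Read off from 0 <= A_k <= (1 - q) A_{k+1} with A_{k+1} > 0. *)
have q1 : 0 <= 1 - Num.sqrt (mu / (L * n%:R)).
  by rewrite -(pmulr_lge0 _ A'0) (le_trans A0).
(* The geometric clause starts at A_1: since A_0 = 0, A_1 = a_1, and the step inequality gives n L
   A_1 >= tau_1 >= 1. *)
have [k0|k_gt0] := posnP k.
  have A'a : aA s k.+1 = aa s k.+1 by rewrite AE k0 sA add0r.
  have -> : (1 - Num.sqrt (mu / (L * n%:R))) ^+ k = 1 by rewrite k0 expr0.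
  move: a2; rewrite tau'E1 -A'a expr2 mulrCA mulr1 (ler_pM2l A'0); lra.
apply: (le_trans (lin k_gt0)).
have -> : (1 - Num.sqrt (mu / (L * n%:R))) ^+ k =
    (1 - Num.sqrt (mu / (L * n%:R))) *
    (1 - Num.sqrt (mu / (L * n%:R))) ^+ (k - 1).
  by rewrite -exprS subn1 prednK.
rewrite mulrA ler_wpM2r ?exprn_ge0// -[leRHS]mulrA (ler_pM2l c0).
by rewrite [leRHS]mulrC.
Qed.

Lemma aam_rate : (1 <= K)%N ->
  f (ax s K) - f z <=
    n%:R * L * norm2 (x0 - z) ^+ 2 *
      Num.min (4 / K%:R ^+ 2) ((1 - Num.sqrt (mu / (n%:R * L))) ^+ (K - 1)).
Proof.
move=> K1; have [A0 tauE lyap quad /(_ K1)] := aam_invariant (leqnn K).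
rewrite ![n%:R * L]mulrC; set p := (1 - _) ^+ _ => lin.
have K0 : 0 < K%:R :> R by rewrite ltr0n.
set c := L * n%:R in quad lin *.
set gap := f (ax s K) - f z in lyap *.
have gap0 : 0 < gap by rewrite subr_gt0.
have c0 : 0 <= c by rewrite mulr_ge0 ?(ltW L_gt0).
have RA : 2 * (aA s K * gap) <= norm2 (x0 - z) ^+ 2.
  have : 0 <= atau s K / 2 * norm2 (z - av s K) ^+ 2.
    by rewrite mulr_ge0 ?sqr_ge0// divr_ge0// tauE addr_ge0// mulr_ge0.
  lra.
set N := norm2 _ ^+ 2 in RA *; have N0 : 0 <= N by rewrite sqr_ge0.
have cAgap : 2 * (c * aA s K) * gap <= c * N.
  by have := ler_wpM2l c0 RA; lra.
have cA0 : 0 < c * aA s K.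
  have : 0 < K%:R ^+ 2 :> R by rewrite exprn_gt0.
  lra.
(* Both bounds come out with a factor 2 to spare, from the 1 / 2 in the Lyapunov function. *)
rewrite (minr_pMr _ _ (mulr_ge0 c0 N0)) le_min; apply/andP; split.
  rewrite mulrA ler_pdivlMr ?exprn_gt0//.
  have := ler_wpM2l (ltW gap0) quad; have := mulr_ge0 c0 N0; lra.
have p0 : 0 < p by rewrite -(pmulr_rgt0 _ cA0) (lt_le_trans ltr01).
have := ler_wpM2l (ltW p0) cAgap; have := ler_wpM2l (ltW gap0) lin.
have := mulr_ge0 (mulr_ge0 c0 N0) (ltW p0); lra.
Qed.

End Rate.

Theorem theorem5p2 (R : realType) (m n : nat) (f : 'rV[R]_m -> R) (L mu : R)
    (I : 'I_n -> {set 'I_m}) (x0 xstar : 'rV[R]_m)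
    (L_known : bool) (s : aam_seq R m n) (k : nat)
    (L_gt0 : 0 < L) (mu_ge0 : 0 <= mu)
    (f_convex : convex_function (setT : set (convex_lmodType 'rV[R]_m)) f)
    (f_smooth : lipschitz_grad L f)
    (f_strong : strongly_convex mu f)
    (xstar_min : is_argmin setT f xstar)
    (I_blocks : is_block_division I)
    (block_min : forall (i : 'I_n) (z : 'rV[R]_m),
       exists x, is_argmin (block_affine (I i) z) f x)
    (k_ge1 : (1 <= k)%N)
    (s_run : aam_run L_known f L mu I x0 k s) :
  f (ax s k) - f xstar <=
    n%:R * L * norm2 (x0 - xstar) ^+ 2 *
      Num.min (4 / k%:R ^+ 2) ((1 - Num.sqrt (mu / (n%:R * L))) ^+ (k - 1)).
Proof.
have [_ cover] := I_blocks; have [_ xmin] := xstar_min.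
have [gap|fx] := ltP (f xstar) (f (ax s k)).
  exact: (aam_rate L_gt0 mu_ge0 f_smooth f_strong cover s_run gap).
apply: (@le_trans _ _ 0); first by rewrite subr_le0.
have [->|x0x] := eqVneq x0 xstar.
  by rewrite subrr -(scale0r (0 : 'rV[R]_m)) norm2Z normr0 mul0r expr0n /=
    mulr0 mul0r.
have muL := strong_le_smooth f_smooth f_strong x0x.
(* Any block index recorded in [s] inhabits ['I_n], whence n >= 1. *)
have n1 : 1 <= n%:R :> R.
  by rewrite ler1n (leq_ltn_trans _ (ltn_ord (aidx s 0%N))).
have c0 : 0 < n%:R * L by rewrite mulr_gt0// (lt_le_trans ltr01).
apply: mulr_ge0; first by rewrite !mulr_ge0 ?norm2_ge0// ltW.
rewrite le_min divr_ge0 ?sqr_ge0// exprn_ge0// subr_ge0.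
rewrite -[leRHS]sqrtr1 ler_wsqrtr// ler_pdivrMr// mul1r.
by apply: (le_trans muL); rewrite ler_peMl// ltW.
Qed.
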